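(* Let $a\in\mathbf{C}$ and let $R$ be a homogeneous (with respect to the $\mathbf{Z}$-grading $\mathcal{W}(a,-1)=\bigoplus_{n\in\mathbf{Z}}(\mathbf{C}L_n+\mathbf{C}I_n)$) block-diagonal Rota--Baxter operator of weight $1$ on the transposed Poisson algebra $\mathcal{W}(a,-1)$, i.e. $R=R|_{\mathbf{W}}\oplus R|_{I(a,-1)}$ leaves both $\mathbf{W}$ and $I(a,-1)$ invariant. Then $R$ is one of the following: (1) $R_0^0\oplus(-\mathrm{Id})$ or $R_0^0\oplus0$; (2) $R_0^{\emptyset}\oplus(-\mathrm{Id})$ or $R_0^{\emptyset}\oplus0$; (3) $R_0^{+,\alpha}\oplus\mathrm{diag}\bigl(-\mathbf{1}_{(-\infty,t]}(n)\mid n\in\mathbf{Z}\bigr)$ for $t\in\mathbf{Z}\sqcup\{\pm\infty\}$ and $\alpha\in\{-1,0\}$; (4) $R_0^{-,\alpha}\oplus\mathrm{diag}\bigl(-\mathbf{1}_{[t,+\infty)}(n)\mid n\in\mathbf{Z}\bigr)$ for $t\in\mathbf{Z}\sqcup\{\pm\infty\}$ and $\alpha\in\{-1,0\}$.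
   Context: All algebras are over $\mathbf{C}$. For $a\in\mathbf{C}$, the transposed Poisson algebra $\mathcal{W}(a,-1)$ is the vector space with basis $\{L_n,I_m\mid n,m\in\mathbf{Z}\}$, with commutative associative product $L_n\cdot L_m=L_{n+m}$, $L_n\cdot I_m=I_{n+m}$, $I_n\cdot I_m=0$, and Lie bracket $[L_n,L_m]=(n-m)L_{n+m}$, $[L_n,I_m]=-(m+a-n)I_{n+m}$, $[I_n,I_m]=0$. $\mathbf{W}$ is the span of the $L_n$ and $I(a,-1)$ the span of the $I_m$. A Rota--Baxter operator of weight $\lambda$ on the transposed Poisson algebra is a linear map $R$ with $R(x)\star R(y)=R\bigl(R(x)\star y+x\star R(y)\bigr)+\lambda R(x\star y)$ for all $x,y$ and both products $\star\in\{\cdot,[\ ,\ ]\}$. For a grading $E=\bigoplus_nE_n$, $R$ is homogeneous of degree $k\in\mathbf{Z}$ if $R(E_n)\subseteq E_{n+k}$ for all $n$; homogeneous means homogeneous of some degree. Operators on $\mathbf{W}$: $R_0^0=0$; $R_0^{\emptyset}(L_n)=-L_n$ for all $n$; $R_0^{+,\alpha}(L_n)=-L_n$ for $n<0$, $\alpha L_0$ for $n=0$, $0$ for $n>0$; $R_0^{-,\alpha}(L_n)=-L_n$ for $n>0$, $\alpha L_0$ for $n=0$, $0$ for $n<0$. The second summand is an operator on $I(a,-1)$; $\mathrm{diag}(c(n)\mid n\in\mathbf{Z})$ means $I_n\mapsto c(n)I_n$, and $\mathbf{1}_S$ is the indicator function of $S$. For $t=\pm\infty$ the interval is understood as empty or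 all of $\mathbf{Z}$ accordingly (so the operators are $0$ or $-\mathrm{Id}$). *)

(* Defs.v *)
From HB Require Import structures.
From mathcomp Require Import all_boot all_order all_algebra.
From mathcomp Require Import finmap monalg complex.
From mathcomp Require Import reals constructive_ereal.
From mathcomp Require Import ring.

Set Implicit Arguments.
Unset Strict Implicit.
Unset Printing Implicit Defensive.

Import Order.TTheory GRing.Theory Num.Theory.
Local Open Scope ring_scope.

Record transposedPoisson (F : fieldType) (V : lmodType F) := TransposedPoisson {
  tp_mul : V -> V -> V;
  tp_brk : V -> V -> V;
  tp_mul_linear : forall x, linear (tp_mul x);
  tp_mulC : commutative tp_mul;
  tp_mulA : associative tp_mul;
  tp_brk_linearl : forall y, linear (tp_brk^~ y);
  tp_brk_linearr : forall x, linear (tp_brk x);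
  tp_brk_alt : forall x, tp_brk x x = 0;
  tp_jacobi : forall x y z,
    tp_brk x (tp_brk y z) + tp_brk y (tp_brk z x) + tp_brk z (tp_brk x y) = 0;
  tp_compat : forall x y z,
    2 *: tp_mul z (tp_brk x y) =
      tp_brk (tp_mul z x) y + tp_brk x (tp_mul z y)
}.

Definition rota_baxter_eq (F : fieldType) (V : lmodType F)
    (star : V -> V -> V) (lambda : F) (T : V -> V) : Prop :=
  forall x y,
    star (T x) (T y) = T (star (T x) y + star x (T y)) + lambda *: T (star x y).

Definition rota_baxter (F : fieldType) (V : lmodType F)
    (P : transposedPoisson V) (lambda : F) (T : {linear V -> V}) : Prop :=
  rota_baxter_eq (tp_mul P) lambda T /\ rota_baxter_eq (tp_brk P) lambda T.

Definition homogeneous_of_degree (V : Type) (E : int -> V -> Prop)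
    (k : int) (T : V -> V) : Prop :=
  forall n x, E n x -> E (n + k) (T x).

Definition homogeneous (V : Type) (E : int -> V -> Prop) (T : V -> V) : Prop :=
  exists k, homogeneous_of_degree E k T.

Definition span (F : fieldType) (V : lmodType F) (e : int -> V) (x : V) : Prop :=
  exists (s : seq int) (c : int -> F), x = \sum_(n <- s) c n *: e n.

Definition invariant (V : Type) (A : V -> Prop) (T : V -> V) : Prop :=
  forall x, A x -> A (T x).

Section LinearExtension.
Context (F : fieldType) (V : lmodType F).

(* the linear (resp. bilinear) map with prescribed values on the basis [<<n>>]
   of the space {malg F[int]} of finitely supported functions int -> F *)
Definition lin_ext (f : int -> V) (x : {malg F[int]}) : V :=
  \sum_(n <- msupp x) x@_n *: f n.

Definition bilin_ext (f : int -> int -> V) (x y : {malg F[int]}) : V :=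
  lin_ext (fun n => lin_ext (f n) y) x.

Lemma lin_extEw (f : int -> V) (x : {malg F[int]}) (d : {fset int}) :
  (msupp x `<=` d)%fset -> lin_ext f x = \sum_(n <- d) x@_n *: f n.
Proof.
move=> sxd; rewrite /lin_ext (big_fset_incl _ sxd) // => n _ nx.
by rewrite mcoeff_outdom // scale0r.
Qed.

Lemma lin_ext_linear (f : int -> V) : linear (lin_ext f).
Proof.
move=> c x y; pose d := (msupp x `|` msupp y)%fset.
rewrite (@lin_extEw f x d) ?fsubsetUl // (@lin_extEw f y d) ?fsubsetUr //.
rewrite (@lin_extEw f _ d); last first.
  apply: (fsubset_trans (msuppD_le _ _)).
  by rewrite fsetSU // msuppZ_le.
rewrite scaler_sumr -big_split /=; apply: eq_bigr => n _.
by rewrite mcoeffD mcoeffZ scalerDl scalerA.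
Qed.

Lemma lin_extU (f : int -> V) n : lin_ext f << n >> = f n.
Proof. by rewrite /lin_ext msuppU oner_eq0 big_seq_fset1 mcoeffUU scale1r. Qed.

HB.instance Definition _ f := GRing.isLinear.Build F {malg F[int]} V *:%R
  (lin_ext f) (lin_ext_linear f).

Lemma bilin_ext_linearl (f : int -> int -> V) y : linear ((bilin_ext f)^~ y).
Proof. by move=> c x x'; rewrite /bilin_ext linearP. Qed.

Lemma bilin_ext_linearr (f : int -> int -> V) x : linear (bilin_ext f x).
Proof.
move=> c y y'; rewrite /bilin_ext /lin_ext scaler_sumr -big_split /=.
apply: eq_bigr => n _; rewrite -![\sum_(_ <- _) _]/(lin_ext _ _) linearP.
by rewrite scalerDr !scalerA mulrC.
Qed.

Lemma bilin_extUU (f : int -> int -> V) n m : bilin_ext f << n >> << m >> = f n m.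
Proof. by rewrite /bilin_ext !lin_extU. Qed.

Lemma bilin_ext0l (f : int -> int -> V) y : bilin_ext f 0 y = 0.
Proof. by rewrite /bilin_ext raddf0. Qed.

Lemma bilin_ext0r (f : int -> int -> V) x : bilin_ext f x 0 = 0.
Proof. by rewrite -[0 in LHS](addNr 0) -scaleN1r bilin_ext_linearr scaleN1r addNr. Qed.

End LinearExtension.

Section Combinations.
Context (F : fieldType) (V : lmodType F).
Implicit Types (c k : F) (v p q r : V).

Lemma comb3 c p p' q q' r r' :
  (c *: p + p') + (c *: q + q') + (c *: r + r') =
  c *: (p + q + r) + (p' + q' + r').
Proof. by rewrite !scalerDr [RHS]addrACA [X in _ = X + _]addrACA. Qed.

Lemma comb3Z k1 k2 k3 c p p' q q' r r' :
  k1 *: (c *: p + p') + k2 *: (c *: q + q') + k3 *: (c *: r + r') =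
  c *: (k1 *: p + k2 *: q + k3 *: r) + (k1 *: p' + k2 *: q' + k3 *: r').
Proof. by rewrite -comb3 !scalerDr !scalerA ![_ * c]mulrC. Qed.

Lemma zero3 k1 k2 k3 v : k1 + k2 + k3 = 0 -> k1 *: v + k2 *: v + k3 *: v = 0.
Proof. by rewrite -!scalerDl => ->; rewrite scale0r. Qed.

Lemma zero3Z k1 k2 k3 l1 l2 l3 v : k1 * l1 + k2 * l2 + k3 * l3 = 0 ->
  k1 *: (l1 *: v) + k2 *: (l2 *: v) + k3 *: (l3 *: v) = 0.
Proof. by rewrite !scalerA; apply: zero3. Qed.

Lemma comb2_eq0 p q r : 2 *: p + -1 *: q + -1 *: r = 0 -> 2 *: p = q + r.
Proof. by move/eqP; rewrite !scaleN1r -addrA -opprD subr_eq0 => /eqP. Qed.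

Lemma comb1_eq0 p q : 1 *: p + -1 *: q + 0 *: p = 0 -> p = q.
Proof. by move/eqP; rewrite scale0r addr0 scale1r scaleN1r subr_eq0 => /eqP. Qed.

Definition trilinear (f : V -> V -> V -> V) : Prop :=
  [/\ forall y z, linear (fun x => f x y z),
      forall x z, linear (fun y => f x y z) &
      forall x y, linear (fun z => f x y z)].

Context (m b : V -> V -> V).
Hypotheses (ml : forall y, linear (m^~ y)) (mr : forall x, linear (m x)).
Hypotheses (bl : forall y, linear (b^~ y)) (br : forall x, linear (b x)).

Lemma trilinear_assoc : trilinear (fun x y z =>
  1 *: m x (m y z) + -1 *: m (m x y) z + 0 *: m x (m y z)).
Proof. by split=> u v c p q; rewrite !(ml, mr) comb3Z. Qed.

Lemma trilinear_jacobi : trilinear (fun x y z =>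
  b x (b y z) + b y (b z x) + b z (b x y)).
Proof. by split=> u v c p q; rewrite !(bl, br) comb3. Qed.

Lemma trilinear_compat : trilinear (fun x y z =>
  2 *: m z (b x y) + -1 *: b (m z x) y + -1 *: b x (m z y)).
Proof. by split=> u v c p q; rewrite !(ml, mr, bl, br) comb3Z. Qed.

End Combinations.

Section WAlgebra.
Context (R : realType).
Local Notation C := R[i].

(* W has basis L_n = (<<n>>, 0) and I(a,-1) has basis I_m = (0, <<m>>). *)
Definition Wspace : lmodType C := ({malg C[int]} * {malg C[int]})%type.

Definition basisL (n : int) : Wspace := (<< n >>, 0).
Definition basisI (m : int) : Wspace := (0, << m >>).

(* The three summands are the products L * L, L * I and I * L; the last one is
   determined by commutativity (resp. antisymmetry for W_brk), and I * I is 0. *)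
Definition W_mul (u v : Wspace) : Wspace :=
  bilin_ext (fun n m => basisL (n + m)) u.1 v.1 +
  bilin_ext (fun n m => basisI (n + m)) u.1 v.2 +
  bilin_ext (fun m n => basisI (n + m)) u.2 v.1.

Definition W_brk (a : C) (u v : Wspace) : Wspace :=
  bilin_ext (fun n m => (n - m)%:~R *: basisL (n + m)) u.1 v.1 +
  bilin_ext (fun n m => - (m%:~R + a - n%:~R) *: basisI (n + m)) u.1 v.2 +
  bilin_ext (fun m n => (m%:~R + a - n%:~R) *: basisI (n + m)) u.2 v.1.

Lemma Wspace_ind (P : Wspace -> Prop) :
    (forall c x y, P x -> P y -> P (c *: x + y)) ->
    (forall n, P (basisL n)) -> (forall n, P (basisI n)) -> forall x, P x.
Proof.
move=> Plin PL PI.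
have P0 : P 0 by rewrite -[0](addNr (basisL 0)) -scaleN1r; apply: Plin.
have Psum (V : {linear {malg C[int]} -> Wspace}) :
    (forall n, P (V << n >>)) -> forall x, P (V x).
  move=> PV x; rewrite [x]monalgE raddf_sum /=.
  elim: (enum_fset (msupp x)) => [|n s IHs]; first by rewrite big_nil.
  rewrite big_cons; have -> : << x@_n *g n >> = x@_n *: << n >> :> {malg C[int]}.
    by apply/malgP => m; rewrite mcoeffZ !mcoeffU mulrnAr mulr1.
  by rewrite linearZ; apply: Plin.
pose j1 (x : {malg C[int]}) : Wspace := (x, 0).
pose j2 (x : {malg C[int]}) : Wspace := (0, x).
have l1 : linear j1 by move=> c x y; congr (_, _); rewrite /= scaler0 addr0.
have l2 : linear j2 by move=> c x y; congr (_, _); rewrite /= scaler0 addr0.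
pose L1 : {linear _ -> _} := HB.pack j1 (GRing.isLinear.Build _ _ _ _ _ l1).
pose L2 : {linear _ -> _} := HB.pack j2 (GRing.isLinear.Build _ _ _ _ _ l2).
move=> [x y]; have -> : (x, y) = 1 *: L1 x + L2 y.
  by rewrite scale1r; congr (_, _); rewrite /= (addr0, add0r).
by apply: Plin; apply: Psum.
Qed.

Let bilin3_linearl (f g h : int -> int -> Wspace) (v : Wspace) :
  linear (fun u : Wspace =>
    bilin_ext f u.1 v.1 + bilin_ext g u.1 v.2 + bilin_ext h u.2 v.1).
Proof. by move=> c x y; rewrite !bilin_ext_linearl; apply: comb3. Qed.

Let bilin3_linearr (f g h : int -> int -> Wspace) (u : Wspace) :
  linear (fun v : Wspace =>
    bilin_ext f u.1 v.1 + bilin_ext g u.1 v.2 + bilin_ext h u.2 v.1).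
Proof. by move=> c x y; rewrite !bilin_ext_linearr; apply: comb3. Qed.

Lemma W_mul_linearl v : linear (W_mul^~ v).
Proof.
exact: bilin3_linearl.
Qed.

Lemma W_mul_linearr u : linear (W_mul u).
Proof.
exact: bilin3_linearr.
Qed.

Lemma W_brk_linearl a v : linear ((W_brk a)^~ v).
Proof.
exact: bilin3_linearl.
Qed.

Lemma W_brk_linearr a u : linear (W_brk a u).
Proof.
exact: bilin3_linearr.
Qed.

Let WE := (bilin_extUU, bilin_ext0l, bilin_ext0r, addr0, add0r).

Let bilin3 (f g h : int -> int -> Wspace) (u v : Wspace) : Wspace :=
  bilin_ext f u.1 v.1 + bilin_ext g u.1 v.2 + bilin_ext h u.2 v.1.

Let bilin3LL f g h n m : bilin3 f g h (basisL n) (basisL m) = f n m.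
Proof. by rewrite /bilin3 /= !WE. Qed.

Let bilin3LI f g h n m : bilin3 f g h (basisL n) (basisI m) = g n m.
Proof. by rewrite /bilin3 /= !WE. Qed.

Let bilin3IL f g h n m : bilin3 f g h (basisI n) (basisL m) = h n m.
Proof. by rewrite /bilin3 /= !WE. Qed.

Let bilin3II f g h n m : bilin3 f g h (basisI n) (basisI m) = 0.
Proof. by rewrite /bilin3 /= !WE. Qed.

Lemma W_mulLL n m : W_mul (basisL n) (basisL m) = basisL (n + m).
Proof. exact: bilin3LL. Qed.

Lemma W_mulLI n m : W_mul (basisL n) (basisI m) = basisI (n + m).
Proof. exact: bilin3LI. Qed.

Lemma W_mulIL m n : W_mul (basisI m) (basisL n) = basisI (n + m).
Proof. exact: bilin3IL. Qed.

Lemma W_mulII n m : W_mul (basisI n) (basisI m) = 0.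
Proof. exact: bilin3II. Qed.

Lemma W_brkLL a n m :
  W_brk a (basisL n) (basisL m) = (n - m)%:~R *: basisL (n + m).
Proof. exact: bilin3LL. Qed.

Lemma W_brkLI a n m :
  W_brk a (basisL n) (basisI m) = - (m%:~R + a - n%:~R) *: basisI (n + m).
Proof. exact: bilin3LI. Qed.

Lemma W_brkIL a m n :
  W_brk a (basisI m) (basisL n) = (m%:~R + a - n%:~R) *: basisI (n + m).
Proof. exact: bilin3IL. Qed.

Lemma W_brkII a n m : W_brk a (basisI n) (basisI m) = 0.
Proof. exact: bilin3II. Qed.

HB.instance Definition _ u := GRing.isLinear.Build C Wspace Wspace *:%R
  (W_mul u) (W_mul_linearr u).

HB.instance Definition _ a u := GRing.isLinear.Build C Wspace Wspace *:%R
  (W_brk a u) (W_brk_linearr a u).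

Let tabE := (W_mulLL, W_mulLI, W_mulIL, W_mulII,
  W_brkLL, W_brkLI, W_brkIL, W_brkII).

Lemma W_mulC : commutative W_mul.
Proof.
elim/Wspace_ind => [c x x' IHx IHx' y|n|n].
- by rewrite W_mul_linearl linearP /= IHx IHx'.
- by elim/Wspace_ind => [c y y' IHy IHy'|m|m];
    [rewrite W_mul_linearl linearP /= IHy IHy' | rewrite !tabE addrC | rewrite !tabE].
- by elim/Wspace_ind => [c y y' IHy IHy'|m|m];
    [rewrite W_mul_linearl linearP /= IHy IHy' | rewrite !tabE | rewrite !tabE].
Qed.

Lemma W_brk_antisym a u v : W_brk a u v = - W_brk a v u.
Proof.
elim/Wspace_ind: u v => [c x x' IHx IHx' y|n|n].
- by rewrite W_brk_linearl linearP /= IHx IHx' scalerN -opprD.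
- elim/Wspace_ind => [c y y' IHy IHy'|m|m].
  + by rewrite W_brk_linearl linearP /= IHy IHy' scalerN -opprD.
  + by rewrite !tabE -scaleNr -rmorphN opprB [m + n]addrC.
  + by rewrite !tabE scaleNr.
- elim/Wspace_ind => [c y y' IHy IHy'|m|m].
  + by rewrite W_brk_linearl linearP /= IHy IHy' scalerN -opprD.
  + by rewrite !tabE scaleNr opprK.
  + by rewrite !tabE oppr0.
Qed.

Lemma W_brk_alt a u : W_brk a u u = 0.
Proof.
have /eqP := W_brk_antisym a u u.
by rewrite -addr_eq0 -mulr2n -scaler_nat scaler_eq0 pnatr_eq0 /= => /eqP.
Qed.

Lemma W_trilinear_eq0 (f : Wspace -> Wspace -> Wspace -> Wspace) :
    trilinear f ->
    (forall b1 b2 b3 : bool, forall n m p,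
      f ((if b1 then basisL else basisI) n)
        ((if b2 then basisL else basisI) m)
        ((if b3 then basisL else basisI) p) = 0) ->
  forall x y z, f x y z = 0.
Proof.
case=> l1 l2 l3 f0 x y z; have lin0 c : c *: 0 + 0 = 0 :> Wspace.
  by rewrite scaler0 addr0.
elim/Wspace_ind: x => [c x x' IHx IHx'|n|n]; first by rewrite l1 IHx IHx'.
- elim/Wspace_ind: y => [c y y' IHy IHy'|m|m]; first by rewrite l2 IHy IHy'.
  + elim/Wspace_ind: z => [c z z' IHz IHz'|p|p]; first by rewrite l3 IHz IHz'.
      exact: (f0 true true true).
    exact: (f0 true true false).
  + elim/Wspace_ind: z => [c z z' IHz IHz'|p|p]; first by rewrite l3 IHz IHz'.
      exact: (f0 true false true).
    exact: (f0 true false false).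
- elim/Wspace_ind: y => [c y y' IHy IHy'|m|m]; first by rewrite l2 IHy IHy'.
  + elim/Wspace_ind: z => [c z z' IHz IHz'|p|p]; first by rewrite l3 IHz IHz'.
      exact: (f0 false true true).
    exact: (f0 false true false).
  + elim/Wspace_ind: z => [c z z' IHz IHz'|p|p]; first by rewrite l3 IHz IHz'.
      exact: (f0 false false true).
    exact: (f0 false false false).
Qed.

Let perm3 (n m p : int) :
  ((n + (m + p) = n + m + p) * (n + (p + m) = n + m + p) *
  (m + (n + p) = n + m + p) * (m + (p + n) = n + m + p) *
  (p + (n + m) = n + m + p) * (p + (m + n) = n + m + p)) *
  ((n + p + m = n + m + p) * (m + n + p = n + m + p) *
  (m + p + n = n + m + p) * (p + n + m = n + m + p) * (p + m + n = n + m + p)).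
Proof. by do !split; ring. Qed.

Lemma W_mul0l v : W_mul 0 v = 0.
Proof. by rewrite W_mulC linear0. Qed.

Lemma W_brk0l a v : W_brk a 0 v = 0.
Proof. by rewrite W_brk_antisym linear0 oppr0. Qed.

Let W_mulZr k u v : W_mul u (k *: v) = k *: W_mul u v.
Proof. exact: linearZ. Qed.

Let W_brkZr a k u v : W_brk a u (k *: v) = k *: W_brk a u v.
Proof. exact: linearZ. Qed.

Let simplE := (tabE, W_mulZr, W_brkZr, W_mul0l, W_brk0l, linear0).

Opaque W_mul W_brk basisL basisI.

Lemma W_mulA : associative W_mul.
Proof.
move=> x y z; apply: comb1_eq0; move: x y z; apply: W_trilinear_eq0.
  exact: (trilinear_assoc W_mul_linearl W_mul_linearr).
have z1 v : 1 *: v + -1 *: v + 0 *: v = 0 :> Wspace by apply: zero3; ring.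
by case=> [] [] [] n m p; rewrite !(simplE, perm3 n m p) ?z1 ?scaler0 ?addr0.
Qed.

Lemma W_jacobi a x y z :
  W_brk a x (W_brk a y z) + W_brk a y (W_brk a z x) + W_brk a z (W_brk a x y)
    = 0.
Proof.
move: x y z; apply: W_trilinear_eq0.
  exact: (trilinear_jacobi (W_brk_linearl a) (W_brk_linearr a)).
case=> [] [] [] n m p; rewrite !(simplE, perm3 n m p) ?scaler0 ?addr0 //.
all: by apply: zero3Z; ring.
Qed.

Lemma W_compat a x y z :
  2 *: W_mul z (W_brk a x y) = W_brk a (W_mul z x) y + W_brk a x (W_mul z y).
Proof.
apply: comb2_eq0; move: x y z; apply: W_trilinear_eq0.
  exact: (trilinear_compat W_mul_linearl W_mul_linearr
    (W_brk_linearl a) (W_brk_linearr a)).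
case=> [] [] [] n m p; rewrite !(simplE, perm3 n m p) ?scaler0 ?addr0 //.
all: by apply: zero3Z; ring.
Qed.

Transparent W_mul W_brk basisL basisI.

Definition W_algebra (a : C) : transposedPoisson Wspace :=
  TransposedPoisson W_mul_linearr W_mulC W_mulA (W_brk_linearl a)
    (W_brk_linearr a) (W_brk_alt a) (W_jacobi a) (W_compat a).

Definition W_grading (n : int) (x : Wspace) : Prop :=
  exists c d : C, x = c *: basisL n + d *: basisI n.

Definition W_part : Wspace -> Prop := span basisL.
Definition I_part : Wspace -> Prop := span basisI.

Definition block_diagonal (T : Wspace -> Wspace) : Prop :=
  invariant W_part T /\ invariant I_part T.

Definition diag (c : int -> C) : {malg C[int]} -> {malg C[int]} :=
  lin_ext (fun n => c n *: << n >>).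

(* A acts on the span of the L_n, B on the span of the I_n *)
Definition oplus (A B : {malg C[int]} -> {malg C[int]}) (x : Wspace) : Wspace :=
  (A x.1, B x.2).

Definition R0_zero : {malg C[int]} -> {malg C[int]} := fun=> 0.

Definition R0_empty : {malg C[int]} -> {malg C[int]} := diag (fun=> -1).

Definition R0_plus (alpha : C) : {malg C[int]} -> {malg C[int]} :=
  diag (fun n => if n < 0 then -1 else if n == 0 then alpha else 0).

Definition R0_minus (alpha : C) : {malg C[int]} -> {malg C[int]} :=
  diag (fun n => if 0 < n then -1 else if n == 0 then alpha else 0).

End WAlgebra.

(* Main.v *)
Require Import Defs.
From mathcomp Require Import all_boot all_order all_algebra.
From mathcomp Require Import finmap monalg complex.
From mathcomp Require Import reals constructive_ereal.
From mathcomp Require Import boolp ring zify.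

Import Order.TTheory GRing.Theory Num.Theory.
Local Open Scope ring_scope.

(** A homogeneous block-diagonal operator of degree [k] is given by two scalar
    sequences, [T L_n = f n L_(n+k)] and [T I_n = g n I_(n+k)]. In the
    Rota-Baxter identity for the commutative product, the weight term lives in
    degree [n + m + k] and all other terms in degree [n + m + 2k]
    ([weight_one_coef]). Hence a nonzero degree kills the weight term and forces
    [T = 0], while in degree 0 one gets
    [f n * f m = (f n + f m + 1) * f (n + m)] and
    [f n * g m = (f n + g m + 1) * g (n + m)].

    Taking [n = 0] shows that [f] and [g] take only the values 0 and -1
    ([weight_one_values]), so they are minus the indicators of predicates
    [b] and [c] on the integers. For such values the equations collapse to an
    implication: if [b n] and [c m] have the same truth value, then so does
    [c (n + m)] ([weight_one_agree]).
    For [c = b], both [b] and its complement are closed under addition, so [b]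
    is determined by [b 1], [b (-1)] and [b 0]
    ([additive_bool_pos], [additive_bool_neg]). If [b 1 = b (-1)] then [b] is
    constant, and so is [c] ([agree_const]); these are the operators that are 0 or
    minus the identity on each summand. Otherwise
    [b] is a half-line up to the value at 0, and translating by the element of
    {1, -1} on which [b] holds makes [c] a down-closed or up-closed subset of
    the integers, that is an interval with an end point in the extended
    integers ([down_closed_interval], [up_closed_interval]). *)

(** * Predicates on the integers *)

(** The end point is the largest element when there is one; a nonempty
    proper down-closed subset is bounded by any integer it misses. *)
Lemma down_closed_interval (c : int -> bool) :
  (forall n, c n -> c (n - 1)) ->
  exists t : \bar int, forall n, c n = (n%:E <= t)%E.
Proof.
move=> c1; have down n (i : nat) : c n -> c (n - i%:Z).
  elim: i => [|i IH] cn; first by rewrite subr0.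
  by have -> : n - i.+1%:Z = n - i%:Z - 1; [lia | exact: c1 (IH cn)].
have le n m : m <= n -> c n -> c m.
  move=> mn cn; have -> : m = n - `|n - m|%N%:Z by lia.
  exact: down.
have [[q nq]|all] := pselect (exists q, ~~ c q); last first.
  exists +oo%E => n; rewrite leey; apply/negPn/negP => nn.
  by apply: all; exists n.
have [[p cp]|none] := pselect (exists p, c p); last first.
  exists -oo%E => n; rewrite leeNy_eq /=; apply/negP => cn.
  by apply: none; exists n.
have bound (i : nat) : c (p + i%:Z) -> (i <= `|q - p|)%N.
  by move=> ci; have [|//] := leP q (p + i%:Z); [move/le/(_ ci); rewrite (negPf nq)|lia].
have ex0 : exists i : nat, c (p + i%:Z) by exists 0; rewrite addr0.
case: (@ex_maxnP (fun i : nat => c (p + i%:Z)) `|q - p|%N ex0 bound) => i ci max_i.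
exists (p + i%:Z)%:E => n; rewrite lee_fin; apply/idP/idP => [cn|/le]; last exact.
have [//|lt_n] := leP n (p + i%:Z).
have := max_i `|n - p|%N; have -> : p + `|n - p|%N%:Z = n by lia.
by move=> /(_ cn); lia.
Qed.

Lemma up_closed_interval (c : int -> bool) :
  (forall n, c n -> c (n + 1)) ->
  exists t : \bar int, forall n, c n = (t <= n%:E)%E.
Proof.
move=> c1; have [n|t ct] := @down_closed_interval (fun n => c (- n)).
  by move=> /c1; rewrite opprB addrC.
by exists (- t)%E => n; rewrite leeNl -EFinN -ct opprK.
Qed.

Section AdditivePredicate.
Variables b c : int -> bool.
Hypothesis bD : forall n m, b n = b m -> b (n + m) = b m.
Hypothesis cD : forall n m, b n = c m -> c (n + m) = c m.

Lemma additive_bool_pos n : 0 < n -> b n = b 1.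
Proof.
case: n => [[|n]|//] // _; elim: n => [//|n IH].
by have -> : Posz n.+2 = n.+1%:Z + 1; [lia | rewrite bD].
Qed.

Lemma additive_bool_neg n : n < 0 -> b n = b (-1).
Proof.
case: n => [//|n] _; elim: n => [//|n IH].
by have -> : Negz n.+1 = Negz n + -1; [lia | rewrite bD].
Qed.

Lemma additive_bool_const : b 1 = b (-1) -> forall n, b n = b 1.
Proof.
move=> b1 n; have [/additive_bool_neg ->//|/additive_bool_pos //|->] := ltgtP n 0.
by rewrite -[0](subrr 1) bD.
Qed.

(** If [c] agrees with the constant value of [b] at one point, translations
    propagate that value everywhere; otherwise [c] is the opposite constant. *)
Lemma agree_const : (forall n, b n = b 1) -> forall n, c n = c 0.
Proof.
move=> b1 n; have [c0|c0] := eqVneq (b n) (c 0); first by rewrite -(cD _ _ c0) addr0.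
have [cn|] := eqVneq (b (- n)) (c n); first by rewrite -(cD _ _ cn) addNr.
by move: c0; rewrite !b1; case: (b 1) (c 0) (c n) => [] [] [].
Qed.

End AdditivePredicate.

(** * The scalar Rota-Baxter equation *)

Section ScalarEquation.
Variable F : fieldType.

Definition weight_one_eq (f g : int -> F) : Prop :=
  forall n m, f n * g m = (f n + g m + 1) * g (n + m).

(** Evaluating at [n = 0] gives [g n * (g n + 1) = 0], the constant [f 0]
    cancelling from both sides. *)
Lemma weight_one_values (f g : int -> F) :
  weight_one_eq f g -> forall n, g n = - (g n != 0)%:R.
Proof.
move=> fg n; have := fg 0 n; rewrite add0r => e.
have /eqP : g n * (g n + 1) = 0.
  have -> : g n * (g n + 1) = (f 0 + g n + 1) * g n - f 0 * g n by ring.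
  by rewrite -e subrr.
rewrite mulf_eq0 addr_eq0 => /orP[] /eqP ->; first by rewrite eqxx oppr0.
by rewrite oppr_eq0 oner_eq0.
Qed.

(** When [f n] and [g m] differ, one of them is 0 and the other -1, so both
    sides of the equation vanish; only the case of equal values has content. *)
Lemma weight_one_agree (f g : int -> F) :
  weight_one_eq f f -> weight_one_eq f g ->
  forall n m, (f n != 0) = (g m != 0) -> (g (n + m) != 0) = (g m != 0).
Proof.
move=> ff fg n m e; have := fg n m.
have := weight_one_values _ _ ff n; have := weight_one_values _ _ fg m.
rewrite e; case: (g m != 0) => -> -> /=; last first.
  by rewrite oppr0 mulr0 !add0r mul1r => <-; rewrite eqxx.
have -> : - 1%:R + - 1%:R + 1 = -1 :> F by ring.
by rewrite !mulN1r => /oppr_inj <-; rewrite oppr_eq0 oner_eq0.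
Qed.

End ScalarEquation.

(** * Homogeneous block-diagonal operators *)

Lemma monomialZ (F : fieldType) (c : F) (n : int) :
  << c *g n >> = c *: << n >> :> {malg F[int]}.
Proof. by apply/malgP => m; rewrite mcoeffZ !mcoeffU mulrnAr mulr1. Qed.

Lemma eq_coef (F : fieldType) (u v w z : F) (p q r s t : int) :
  u *: << p >> = v *: << q >> + w *: << r >> + z *: << s >> :> {malg F[int]} ->
  u * << p >>@_t = v * << q >>@_t + w * << r >>@_t + z * << s >>@_t :> F.
Proof.
by move/(congr1 (mcoeff t)); rewrite mcoeffZ 2!mcoeffD 3!mcoeffZ.
Qed.

(** The two degrees [n + m + 2k] and [n + m + k] coincide exactly when [k = 0];
    otherwise the weight term stands alone in its degree. *)
Lemma weight_one_coef (F : fieldType) (f g : int -> F) (k : int) :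
  (forall n m, (f n * g m) *: << n + k + (m + k) >> =
     (f n * g (n + k + m)) *: << n + k + m + k >> +
     (g m * g (n + (m + k))) *: << n + (m + k) + k >> +
     g (n + m) *: << n + m + k >> :> {malg F[int]}) ->
  (k = 0 -> weight_one_eq _ f g) /\ (k <> 0 -> forall n, g n = 0).
Proof.
move=> fg; split=> [k0 n m|k0 n].
  have := eq_coef _ _ _ _ _ _ _ _ _ (n + m) (fg n m); rewrite k0 !addr0.
  by rewrite mcoeffUU !mulr1 => ->; ring.
have other p : p = n + k + k -> << p >>@_(n + k) = 0 :> F.
  by move=> pE; rewrite mcoeffU; have -> : (p == n + k) = false by lia.
have := eq_coef _ _ _ _ _ _ _ _ _ (n + k) (fg 0 n).
rewrite (other (0 + k + (n + k))); last lia.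
rewrite (other (0 + k + n + k)); last lia.
rewrite (other (0 + (n + k) + k)); last lia.
by rewrite !mulr0 !add0r mcoeffUU mulr1.
Qed.

(** The operators of interest send each basis vector to a multiple of another
    basis vector, and products of basis vectors are basis vectors; on such
    arguments the operator identity becomes an identity of coefficients. The
    form with arbitrary [star] covers the products L * L and L * I at once. *)
Lemma rota_baxter_monomial (F : fieldType) (V : lmodType F)
    (star : V -> V -> V) (T : {linear V -> V}) (x x' y y' : V) (u v : F) :
  (forall z, linear (star^~ z)) -> (forall z, linear (star z)) ->
  rota_baxter_eq star 1 T -> T x = u *: x' -> T y = v *: y' ->
  forall z1 z2 z3 p q w,
  T (star x' y) = p *: z1 -> T (star x y') = q *: z2 -> T (star x y) = w *: z3 ->
  (u * v) *: star x' y' = (u * p) *: z1 + (v * q) *: z2 + w *: z3.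
Proof.
move=> linl linr RB Tx Ty z1 z2 z3 p q w T1 T2 T3.
have mapZ (h : V -> V) c s : linear h -> h (c *: s) = c *: h s.
  by move/GRing.scalable_linear; apply.
have := RB x y; rewrite Tx Ty (mapZ (star^~ _)) // !(mapZ (star _)) // (mapZ (star^~ _)) //.
rewrite linearD !linearZ /= T1 T2 T3.
by rewrite !scalerA mul1r [v * u]mulrC.
Qed.

Section Operators.
Variable R : realType.
Local Notation C := R[i].

Lemma eq_diag (c d : int -> C) : c =1 d -> diag c =1 diag d.
Proof. by move=> cd x; apply: eq_bigr => n _; rewrite cd. Qed.

Lemma eq_oplus_diag (f f' g g' : int -> C) : f =1 f' -> g =1 g' ->
  oplus (diag f) (diag g) =1 oplus (diag f') (diag g').
Proof. by move=> ff' gg' x; rewrite /oplus (eq_diag _ _ ff') (eq_diag _ _ gg'). Qed.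

Lemma diag_scale (k : C) x : diag (fun=> k) x = k *: x.
Proof.
rewrite /diag /lin_ext [x in RHS]monalgE scaler_sumr; apply: eq_bigr => n _.
by rewrite [in RHS]monomialZ !scalerA mulrC.
Qed.

Lemma Wspace_eq (x y : Wspace R) : x.1 = y.1 -> x.2 = y.2 -> x = y.
Proof. by case: x y => [x1 x2] [y1 y2] /= -> ->. Qed.

Lemma W_part_snd (x : Wspace R) : W_part x -> x.2 = 0.
Proof.
case=> s [c ->]; elim: s => [|n s IH]; first by rewrite big_nil.
by rewrite big_cons /= IH addr0 scaler0.
Qed.

Lemma I_part_fst (x : Wspace R) : I_part x -> x.1 = 0.
Proof.
case=> s [c ->]; elim: s => [|n s IH]; first by rewrite big_nil.
by rewrite big_cons /= IH addr0 scaler0.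
Qed.

Lemma W_part_basisL n : W_part (basisL R n).
Proof. by exists [:: n], (fun=> 1); rewrite big_seq1 scale1r. Qed.

Lemma I_part_basisI n : I_part (basisI R n).
Proof. by exists [:: n], (fun=> 1); rewrite big_seq1 scale1r. Qed.

Lemma block_homogeneous_coefs (T : Wspace R -> Wspace R) k :
  homogeneous_of_degree (@W_grading R) k T -> block_diagonal T ->
  exists f g : int -> C,
    (forall n, T (basisL R n) = f n *: basisL R (n + k)) /\
    (forall n, T (basisI R n) = g n *: basisI R (n + k)).
Proof.
move=> hom [TW TI].
have homL n : exists c, T (basisL R n) = c *: basisL R (n + k).
  have [|c [d e]] := hom n (basisL R n).
    by exists 1, 0; rewrite scale1r scale0r addr0.
  exists c; have := W_part_snd _ (TW _ (W_part_basisL n)); rewrite e /= scaler0 add0r => d0.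
  by apply: Wspace_eq; rewrite /= !scaler0 ?d0 !addr0.
have homI n : exists d, T (basisI R n) = d *: basisI R (n + k).
  have [|c [d e]] := hom n (basisI R n).
    by exists 0, 1; rewrite scale1r scale0r add0r.
  exists d; have := I_part_fst _ (TI _ (I_part_basisI n)); rewrite e /= scaler0 addr0 => c0.
  by apply: Wspace_eq; rewrite /= !scaler0 ?c0 !add0r.
have [f fE] := choice homL; have [g gE] := choice homI.
exists f, g; split; [exact: fE | exact: gE].
Qed.

Lemma rota_baxter_coefs (a : C) (T : {linear Wspace R -> Wspace R}) k
    (f g : int -> C) :
  (forall n, T (basisL R n) = f n *: basisL R (n + k)) ->
  (forall n, T (basisI R n) = g n *: basisI R (n + k)) ->
  rota_baxter (W_algebra a) 1 T ->
  ((k = 0 -> weight_one_eq _ f f) /\ (k <> 0 -> forall n, f n = 0)) /\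
  ((k = 0 -> weight_one_eq _ f g) /\ (k <> 0 -> forall n, g n = 0)).
Proof.
move=> TL TI [RB _].
split; apply: weight_one_coef => n m.
  have := rota_baxter_monomial _ _ _ _ _ _ _ _ _ _
    (@W_mul_linearl R) (@W_mul_linearr R) RB (TL n) (TL m).
  rewrite !W_mulLL => /(_ _ _ _ _ _ _ (TL _) (TL _) (TL _)).
  by move/(congr1 fst).
have := rota_baxter_monomial _ _ _ _ _ _ _ _ _ _
  (@W_mul_linearl R) (@W_mul_linearr R) RB (TL n) (TI m).
rewrite !W_mulLI => /(_ _ _ _ _ _ _ (TI _) (TI _) (TI _)).
by move/(congr1 snd).
Qed.

Lemma diagonal_operator (T : {linear Wspace R -> Wspace R}) (f g : int -> C) :
  (forall n, T (basisL R n) = f n *: basisL R n) ->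
  (forall n, T (basisI R n) = g n *: basisI R n) ->
  T =1 oplus (diag f) (diag g).
Proof.
move=> TL TI; elim/Wspace_ind => [c x y IHx IHy|n|n].
- rewrite linearP IHx IHy /oplus /diag /=.
  by congr pair; rewrite /= linearP.
- rewrite TL /oplus /diag /=; congr pair; rewrite /= ?lin_extU ?scaler0 //.
  by rewrite linear0.
- rewrite TI /oplus /diag /=; congr pair; rewrite /= ?lin_extU ?scaler0 //.
  by rewrite linear0.
Qed.

End Operators.

(** * Classification *)

Theorem theorem4p7 (R : realType) (a : R[i]) (T : {linear Wspace R -> Wspace R})
    (T_hom : homogeneous (@W_grading R) T)
    (T_block : block_diagonal T)
    (T_RB : rota_baxter (W_algebra a) 1 T) :
  [\/ T =1 oplus (@R0_zero R) (fun x => - x) \/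
       T =1 oplus (@R0_zero R) (fun=> 0),
      T =1 oplus (@R0_empty R) (fun x => - x) \/
       T =1 oplus (@R0_empty R) (fun=> 0),
      exists (t : \bar int) (alpha : R[i]),
        (alpha = -1 \/ alpha = 0) /\
        T =1 oplus (R0_plus alpha)
               (diag (fun n => - ((n%:E <= t)%E)%:R))
    | exists (t : \bar int) (alpha : R[i]),
        (alpha = -1 \/ alpha = 0) /\
        T =1 oplus (R0_minus alpha)
               (diag (fun n => - ((t <= n%:E)%E)%:R))].
Proof.
have [k homk] := T_hom; have [f [g [TL TI]]] := block_homogeneous_coefs _ _ _ homk T_block.
have [[ff f0] [fg g0]] := rota_baxter_coefs _ _ _ _ _ _ TL TI T_RB.
have d0 (x : {malg R[i][int]}) : diag (fun=> 0) x = 0.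
  by rewrite diag_scale scale0r.
have dN1 (x : {malg R[i][int]}) : diag (fun=> -1) x = - x.
  by rewrite diag_scale scaleN1r.
have [k0|/eqP k0] := eqVneq k 0; last first.
  have TE : T =1 oplus (diag (fun=> 0)) (diag (fun=> 0)).
    by apply: diagonal_operator => n;
      [rewrite TL (f0 k0) | rewrite TI (g0 k0)]; rewrite [LHS]scale0r [RHS]scale0r.
  by apply: Or41; right => x; rewrite TE /oplus !d0.
move: ff fg => /(_ k0) ff /(_ k0) fg.
have TE : T =1 oplus (diag f) (diag g).
  by apply: diagonal_operator => n; [rewrite TL | rewrite TI]; rewrite k0 addr0.
pose b n := f n != 0; pose c n := g n != 0.
have fE n : f n = - (b n)%:R by apply: (weight_one_values _ _ f).
have gE n : g n = - (c n)%:R by apply: (weight_one_values _ f g).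
have bD n m : b n = b m -> b (n + m) = b m by apply: weight_one_agree.
have cD n m : b n = c m -> c (n + m) = c m by apply: weight_one_agree.
have alphaP : f 0 = -1 \/ f 0 = 0.
  by rewrite fE; case: (b 0); [left | right; rewrite oppr0].
have [b1|b1] := eqVneq (b 1) (b (-1)).
  have bE := additive_bool_const _ bD b1; have cE := agree_const _ _ cD bE.
  have fK : f =1 (fun=> - (b 1)%:R) by move=> n; rewrite fE bE.
  have gK : g =1 (fun=> - (c 0)%:R) by move=> n; rewrite gE cE.
  have {}TE x : T x = oplus (diag (fun=> - (b 1)%:R)) (diag (fun=> - (c 0)%:R)) x.
    by rewrite TE; apply: eq_oplus_diag.
  case: (b 1) TE => TE; [apply: Or42 | apply: Or41];
    case: (c 0) TE => TE; [left|right|left|right] => x;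
    by rewrite TE /oplus ?oppr0 ?d0 ?dN1 //= /R0_empty dN1.
case bN1: (b (-1)) b1 => b1.
- have {}b1 : b 1 = false by case: (b 1) b1.
  have [n cn|t ct] := down_closed_interval c.
    by rewrite addrC cD // bN1 cn.
  apply: Or43; exists t, (f 0); split=> [|x]; first exact: alphaP.
  rewrite TE /R0_plus; apply: eq_oplus_diag => n; last by rewrite gE ct.
  rewrite fE; have [/(additive_bool_neg _ bD)->|/(additive_bool_pos _ bD)->|->] := ltgtP n 0.
  + by rewrite bN1.
  + by rewrite b1 oppr0.
  + by rewrite -fE.
- have {}b1 : b 1 by case: (b 1) b1.
  have [n cn|t ct] := up_closed_interval c.
    by rewrite addrC cD // b1 cn.
  apply: Or44; exists t, (f 0); split=> [|x]; first exact: alphaP.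
  rewrite TE /R0_minus; apply: eq_oplus_diag => n; last by rewrite gE ct.
  rewrite fE; have [/(additive_bool_neg _ bD)->|/(additive_bool_pos _ bD)->|->] := ltgtP n 0.
  + by rewrite bN1 oppr0.
  + by rewrite b1.
  + by rewrite -fE.
Qed.
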